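(* Let $W\in\mathbb{R}^{m\times n}$, let $q=\min\{m,n\}$, and let $r$ be an integer with $1\le r\le q$. Let $x$ be a random row vector in $\mathbb{R}^{1\times m}$ and $g$ a random row vector in $\mathbb{R}^{1\times n}$ with finite second moments, and put $X=\mathbb{E}[x^{\top}x]\in\mathbb{R}^{m\times m}$ and $G=\mathbb{E}[g^{\top}g]\in\mathbb{R}^{n\times n}$. Let $X=S_x^{\top}S_x$ and $G=S_gS_g^{\top}$ be Cholesky factorizations, with $S_x\in\mathbb{R}^{m\times m}$ and $S_g\in\mathbb{R}^{n\times n}$ nonsingular. For $\widehat W\in\mathbb{R}^{m\times n}$ define the estimated compression-induced loss increase $$J(\widehat W)=\frac12\,\mathrm{vec}(\widehat W-W)^{\top}(G\otimes X)\,\mathrm{vec}(\widehat W-W).$$ Let $\widetilde W=S_xWS_g$ and let $\widetilde W=U\Sigma V^{\top}$ be a singular value decomposition, where $\Sigma=\operatorname{diag}(\sigma_1,\ldots,\sigma_q)$ with $\sigma_1\ge\cdots\ge\sigma_q\ge 0$. Then $$\widehat W_r^{\star}=S_x^{-1}U_r\Sigma_rV_r^{\top}S_g^{-1}$$ minimizes $J(\widehat W)$ over all $\widehat W\in\mathbb{R}^{m\times n}$ with $\operatorname{rank}(\widehat W)\le r$, and the corresponding minimal value (the estimated truncation loss) is $$J(\widehat W_r^{\star})=\frac12\sum_{i=r+1}^{q}\sigma_i^2.$$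
   Context: $\mathrm{vec}(\cdot)$ denotes column-stacking vectorization of a matrix and $\otimes$ the Kronecker product, so that $\mathrm{vec}(ABC)=(C^{\top}\otimes A)\,\mathrm{vec}(B)$. The SVD is in thin form: $U\in\mathbb{R}^{m\times q}$ and $V\in\mathbb{R}^{n\times q}$ have orthonormal columns. $U_r$ and $V_r$ denote the matrices formed by the first $r$ columns of $U$ and $V$, and $\Sigma_r=\operatorname{diag}(\sigma_1,\ldots,\sigma_r)$. Interpretation: $W$ is the weight of a linear layer $y=xW$, $x$ is the input activation, $g$ is the gradient of the per-sample loss with respect to $y$, and the expectations are estimated over a calibration set. The quantity $J(\widehat W)$ is the Kronecker-factored (K-FAC) second-order surrogate that is taken, by assumption, as the estimate of the loss increase caused by replacing $W$ with $\widehat W$. ''Rank-$r$ approximation'' means a matrix of rank at most $r$. *)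

(* Defs.v *)
From HB Require Import structures.
From mathcomp Require Import all_boot all_order all_algebra.
From mathcomp Require Import all_classical all_reals all_analysis.
From mathcomp.real_closed Require Export mxtens.

Set Implicit Arguments.
Unset Strict Implicit.
Unset Printing Implicit Defensive.

Import Order.TTheory GRing.Theory Num.Theory.
Local Open Scope ring_scope.

(* Column stacking: [mxtens_unindex k] is the pair (k %/ m, k %% m), so the    *)
(* entry A i j sits at position j * m + i.                                    *)
Definition vec (R : Type) (m n : nat) (A : 'M[R]_(m, n)) : 'cV[R]_(n * m) :=
  \col_k A (mxtens_unindex k).2 (mxtens_unindex k).1.

(* [vec] and the Kronecker product [*t] use compatible index orders. *)
Lemma vec_mulmx3 (R : comPzRingType) (m n p q : nat)
    (A : 'M[R]_(m, n)) (B : 'M[R]_(n, p)) (C : 'M[R]_(p, q)) :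
  vec (A *m B *m C) = (C^T *t A) *m vec B.
Proof.
apply/colP => k; rewrite !mxE.
transitivity (\sum_j \sum_i C j (mxtens_unindex k).1
    * A (mxtens_unindex k).2 i * B i j).
  apply: eq_bigr => j _; rewrite mxE mulr_suml; apply: eq_bigr => i _.
  by rewrite mulrC mulrA.
rewrite pair_bigA (reindex (@mxtens_unindex p n)) /=; last first.
  by exists (@mxtens_index p n) => ? _; rewrite (mxtens_indexK, mxtens_unindexK).
by apply: eq_bigr => l _; rewrite !mxE.
Qed.

Section SecondMoment.
Context d (T : measurableType d) (R : realType) (P : probability T R).

(* Random row vector whose coordinates are measurable and square integrable;  *)
(* measurability is part of [Lfun].                                           *)
Definition finite_second_moment (m : nat) (x : T -> 'rV[R]_m) : Prop :=
  forall i : 'I_m, (fun t => x t 0 i) \in Lfun P 2%:E.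

Definition mxexpectation (m n : nat) (A : T -> 'M[R]_(m, n)) : 'M[R]_(m, n) :=
  \matrix_(i, j) fine ('E_P[fun t => A t i j])%E.

Definition second_moment (m : nat) (x : T -> 'rV[R]_m) : 'M[R]_m :=
  mxexpectation (fun t => (x t)^T *m x t).

End SecondMoment.

(* [is_trig_mx] means lower triangular, so a factorization A = S^T S with S   *)
(* upper triangular is [is_cholesky A S^T]. The diagonal is only required to  *)
(* be nonnegative; it is positive when L is invertible.                       *)
Definition is_cholesky (R : numDomainType) (n : nat) (A L : 'M[R]_n) : Prop :=
  [/\ is_trig_mx L, forall i, 0 <= L i i & A = L *m L^T].

Definition is_thin_svd (R : numDomainType) (m n : nat) (A : 'M[R]_(m, n))
    (U : 'M[R]_(m, minn m n)) (s : 'rV[R]_(minn m n))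
    (V : 'M[R]_(n, minn m n)) : Prop :=
  [/\ U^T *m U = 1%:M,
      V^T *m V = 1%:M,
      forall i, 0 <= s 0 i,
      forall i j : 'I_(minn m n), (i <= j)%N -> s 0 j <= s 0 i
    & A = U *m diag_mx s *m V^T].

Definition first_cols (R : Type) (m q r : nat) (hr : (r <= q)%N)
    (A : 'M[R]_(m, q)) : 'M[R]_(m, r) :=
  colsub (widen_ord hr) A.

Definition kfac_loss (R : numFieldType) (m n : nat) (X : 'M[R]_m) (G : 'M[R]_n)
    (W What : 'M[R]_(m, n)) : R :=
  2^-1 * ((vec (What - W))^T *m (G *t X) *m vec (What - W)) 0 0.

(* Main.v *)
(** In terms of the whitened weight A = Sx W Sg the loss J is half a squared
    Frobenius distance, so the claim is the Eckart-Young theorem.  If B has rank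
    at most r and Q is the orthogonal projector onto its column space, then
    |A - B|^2 >= |(1 - Q) A|^2 = |A|^2 - \sum_i p_i s_i^2 where p_i = |Q u_i|^2.
    The weights p_i lie in [0, 1] and add up to at most tr Q <= r, so the
    weighted sum is largest when p is 1 on the r largest s_i^2 and 0 elsewhere. *)

Require Import Defs.
From mathcomp Require Import all_boot all_order all_algebra.
From mathcomp Require Import all_classical all_reals all_analysis.
From mathcomp Require Import lra.

Import Order.TTheory GRing.Theory Num.Theory.
Local Open Scope ring_scope.

Definition sqfrob {R : pzRingType} {m n : nat} (A : 'M[R]_(m, n)) : R :=
  \tr (A^T *m A).

Lemma trmx_mul_diagE {R : pzRingType} {m n : nat} (A : 'M[R]_(m, n)) (j : 'I_n) :
  (A^T *m A) j j = \sum_i A i j ^+ 2.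
Proof. by rewrite mxE; apply: eq_bigr => i _; rewrite mxE expr2. Qed.

Lemma trmx_mul_diag_ge0 {R : realDomainType} {m n : nat} (A : 'M[R]_(m, n))
    (j : 'I_n) : 0 <= (A^T *m A) j j.
Proof. by rewrite trmx_mul_diagE; apply: sumr_ge0 => i _; exact: sqr_ge0. Qed.

Lemma sqfrob_ge0 {R : realDomainType} {m n : nat} (A : 'M[R]_(m, n)) :
  0 <= sqfrob A.
Proof. by apply: sumr_ge0 => j _; exact: trmx_mul_diag_ge0. Qed.

Lemma sqfrob_eq0 {R : realDomainType} {m n : nat} (A : 'M[R]_(m, n)) :
  sqfrob A = 0 -> A = 0.
Proof.
move=> /eqP; rewrite psumr_eq0; last by move=> j _; exact: trmx_mul_diag_ge0.
move=> /allP A0; apply/matrixP => i j; rewrite mxE.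
have := A0 j (mem_index_enum j).
rewrite /= trmx_mul_diagE psumr_eq0; last by move=> k _; exact: sqr_ge0.
by move=> /allP/(_ i (mem_index_enum i)); rewrite /= sqrf_eq0 => /eqP.
Qed.

Lemma sqfrobN {R : pzRingType} {m n : nat} (A : 'M[R]_(m, n)) :
  sqfrob (- A) = sqfrob A.
Proof. by rewrite /sqfrob linearN /= mulNmx mulmxN opprK. Qed.

Lemma sqfrob_isometry {R : comPzRingType} {m n q : nat} (U : 'M[R]_(m, q))
    (D : 'M[R]_q) (V : 'M[R]_(n, q)) :
  U^T *m U = 1%:M -> V^T *m V = 1%:M -> sqfrob (U *m D *m V^T) = sqfrob D.
Proof.
move=> hU hV; rewrite /sqfrob !trmx_mul trmxK.
rewrite mxtrace_mulC !mulmxA -(mulmxA _ V^T V) hV mulmx1.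
by rewrite mxtrace_mulC !mulmxA hU mul1mx mxtrace_mulC.
Qed.

Lemma sqfrob_diag {R : pzRingType} {q : nat} (s : 'rV[R]_q) :
  sqfrob (diag_mx s) = \sum_i s 0 i ^+ 2.
Proof.
rewrite /sqfrob tr_diag_mx mulmx_diag mxtrace_diag.
by apply: eq_bigr => i _; rewrite mxE expr2.
Qed.

(** Both sides are the entrywise sum of [A i j * B i j]; [mxtens_index] splits the single index of
    [vec] into a pair. *)
Lemma vec_dotE {R : comPzRingType} {m n : nat} (A B : 'M[R]_(m, n)) :
  ((vec A)^T *m vec B) 0 0 = \tr (A^T *m B).
Proof.
rewrite mxE (reindex (fun p => mxtens_index p)) /=; last first.
  by exists (@mxtens_unindex n m) => ? _; rewrite (mxtens_indexK, mxtens_unindexK).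
rewrite /mxtrace; under [RHS]eq_bigr do rewrite mxE.
rewrite pair_bigA; apply: eq_bigr => -[j i] _ /=.
by rewrite !mxE mxtens_indexK.
Qed.

(** With [E = What - W], the quadratic form equals tr(E^T Sx^T Sx E Sg Sg^T), and cyclicity of the
    trace moves [Sg^T] to the front. *)
Lemma kfac_lossE {R : numFieldType} {m n : nat} (Sx : 'M[R]_m) (Sg : 'M[R]_n)
    (W What : 'M[R]_(m, n)) :
  kfac_loss (Sx^T *m Sx) (Sg *m Sg^T) W What
    = 2^-1 * sqfrob (Sx *m What *m Sg - Sx *m W *m Sg).
Proof.
rewrite /kfac_loss -mulmxBl -mulmxBr; set E := What - W; congr (_ * _).
(* [vec_mulmx3] expects a transposed left Kronecker factor. *)
have <- : (Sg *m Sg^T)^T = Sg *m Sg^T by rewrite trmx_mul trmxK.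
rewrite -mulmxA -vec_mulmx3 vec_dotE /sqfrob !trmx_mul !mulmxA.
by rewrite mxtrace_mulC !mulmxA.
Qed.

(** If K C^T C = 0 then |C K^T|^2 = tr(K C^T C K^T) = 0, so K C^T = 0, and K = 0 by freeness. *)
Lemma gram_unitmx {R : realFieldType} {m k : nat} (C : 'M[R]_(m, k)) :
  row_free C^T -> C^T *m C \in unitmx.
Proof.
move=> Cfree; rewrite -row_free_unit -kermx_eq0; apply/eqP.
set K := kermx _; have KC : K *m C^T = 0.
  apply: trmx_inj; rewrite trmx0; apply: sqfrob_eq0.
  rewrite /sqfrob trmxK trmx_mul trmxK !mulmxA -(mulmxA K) mulmx_ker mul0mx.
  by rewrite mxtrace0.
by apply: (row_free_inj Cfree); rewrite KC mul0mx.
Qed.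

(** Take Q = C (C^T C)^-1 C^T, where the columns of C form a basis of the column space of [B]. By
    cyclicity its trace is that of the identity of size [\rank B]. *)
Lemma orthogonal_projector {R : realFieldType} {m n : nat} (B : 'M[R]_(m, n)) :
  exists Q : 'M[R]_m,
    [/\ Q^T = Q, Q *m Q = Q, Q *m B = B & \tr Q = (\rank B)%:R].
Proof.
have [C [D BE uM]] : exists C : 'M[R]_(m, \rank B),
  exists2 D : 'M[R]_(\rank B, n),
      B = C *m D & C^T *m C \in unitmx.
  exists (col_base B); exists (row_base B); rewrite ?mulmx_base //.
  by apply: gram_unitmx; rewrite /row_free mxrank_tr; exact: col_base_full.
have QC : C *m invmx (C^T *m C) *m C^T *m C = C by rewrite -mulmxA mulmxKV.
exists (C *m invmx (C^T *m C) *m C^T); split.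
- by rewrite !trmx_mul trmx_inv trmx_mul !trmxK mulmxA.
- by rewrite !mulmxA QC.
(* [B] also occurs in the type of [C] through [\rank B], so only the right factor is replaced. *)
- transitivity (C *m invmx (C^T *m C) *m C^T *m (C *m D)); first by congr mulmx.
  by rewrite mulmxA QC.
- by rewrite mxtrace_mulC mulmxA mulmxV // mxtrace1.
Qed.

Section OrthogonalProjector.
Context {R : realDomainType} {m : nat} (Q : 'M[R]_m).
Hypotheses (Qsym : Q^T = Q) (Qidem : Q *m Q = Q).

Lemma projector_gram {n : nat} (A : 'M[R]_(m, n)) :
  (Q *m A)^T *m (Q *m A) = A^T *m Q *m A.
Proof. by rewrite trmx_mul Qsym mulmxA -(mulmxA _ Q Q) Qidem. Qed.

Lemma projector_gramC {n : nat} (A : 'M[R]_(m, n)) :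
  (A - Q *m A)^T *m (A - Q *m A) = A^T *m A - A^T *m Q *m A.
Proof.
rewrite [(A - _)^T]linearB /= mulmxBl !mulmxBr projector_gram trmx_mul Qsym !mulmxA.
by rewrite subrr subr0.
Qed.

(** Pythagoras: the Gram matrices of the two components add up to that of [A]. *)
Lemma sqfrob_projector {n : nat} (A : 'M[R]_(m, n)) :
  sqfrob A = sqfrob (Q *m A) + sqfrob (A - Q *m A).
Proof.
by rewrite /sqfrob projector_gram projector_gramC raddfB /= addrC subrK.
Qed.

(** For the unit column u_i the entry is |Q u_i|^2, and 1 minus it is |u_i - Q u_i|^2. *)
Lemma projector_diag_itv {q : nat} (U : 'M[R]_(m, q)) (i : 'I_q) :
  U^T *m U = 1%:M -> 0 <= (U^T *m Q *m U) i i <= 1.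
Proof.
move=> hU; rewrite -projector_gram trmx_mul_diag_ge0 /=.
have := trmx_mul_diag_ge0 (U - Q *m U) i.
by rewrite projector_gramC hU projector_gram !mxE eqxx subr_ge0.
Qed.

(** Bessel's inequality: the gap between the two sides is |Q - U U^T Q|^2. *)
Lemma projector_trace_le {q : nat} (U : 'M[R]_(m, q)) :
  U^T *m U = 1%:M -> \tr (U^T *m Q *m U) <= \tr Q.
Proof.
move=> hU; rewrite -subr_ge0.
have := sqfrob_ge0 (Q - U *m U^T *m Q).
rewrite /sqfrob [(Q - _)^T]linearB /= !trmx_mul trmxK Qsym mulmxBl !mulmxBr !mulmxA.
rewrite -(mulmxA (Q *m U) U^T U) hU mulmx1 subrr subr0 Qidem raddfB /=.
by rewrite mxtrace_mulC !mulmxA Qidem mxtrace_mulC !mulmxA.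
Qed.

End OrthogonalProjector.

Lemma weighted_sum_le {R : realDomainType} {q r : nat} (w p : 'I_q -> R) :
    (0 < r <= q)%N -> (forall i, 0 <= w i) ->
    (forall i j : 'I_q, (i <= j)%N -> w j <= w i) ->
    (forall i, 0 <= p i <= 1) -> \sum_i p i <= r%:R ->
  \sum_i w i * p i <= \sum_(i < q | (i < r)%N) w i.
Proof.
move=> /andP[r0 rq] w0 wmono p01 psum.
have r1q : (r.-1 < q)%N by rewrite prednK.
(* The smallest of the r leading weights; indices start at 0. It acts as the multiplier of the
   constraint on the sum of [p]. *)
pose c := w (Ordinal r1q).
(* Termwise, as w i - c is nonnegative for i < r and nonpositive for i >= r. *)
have term i : w i * p i <= (if (i < r)%N then w i - c else 0) + c * p i.
  have /andP[p0 p1] := p01 i; case: ltnP => ir.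
    have : c <= w i by apply: wmono; rewrite /= -ltnS prednK.
    by move=> ?; nra.
  have : w i <= c by apply: wmono; rewrite /= (leq_trans (leq_pred _)).
  by move=> ?; nra.
apply: (le_trans (ler_sum _ (fun i _ => term i))).
rewrite big_split /= -mulr_sumr -big_mkcond /= sumrB sumr_const.
have -> : #|[pred i : 'I_q | (i < r)%N]| = r.
  by rewrite -sum1_card -(big_ord_widen _ (fun=> 1%N) rq) sum1_card card_ord.
(* Since c >= 0, the term c * \sum_i p i is at most c * r, which cancels the r copies of c
   subtracted in the termwise bound. *)
have := ler_wpM2l (w0 (Ordinal r1q)) psum; rewrite -/c -mulr_natr.
lra.
Qed.

Section ThinSVD.
Context {R : realFieldType} {m n r : nat} (hrq : (r <= minn m n)%N).
Context {A : 'M[R]_(m, n)} {U : 'M[R]_(m, minn m n)} {s : 'rV[R]_(minn m n)}.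
Context {V : 'M[R]_(n, minn m n)} (hsvd : is_thin_svd A U s V).

(** Zeroing the tail of [s] instead of dropping columns keeps the factors [U] and [V] of [A], so the
    difference from [A] has a diagonal core. *)
Lemma truncated_svdE :
  first_cols hrq U *m diag_mx (first_cols hrq s) *m (first_cols hrq V)^T
    = U *m diag_mx (\row_i (if (i < r)%N then s 0 i else 0)) *m V^T.
Proof.
apply/matrixP => i j; rewrite !mul_mx_diag !mxE.
rewrite [RHS](bigID (fun k : 'I__ => (k < r)%N)) /= [X in _ + X]big1 ?addr0.
  rewrite (big_ord_narrow hrq); apply: eq_bigr => k _.
  by rewrite !mxE /= ltn_ord.
by move=> k /negPf kr; rewrite !mxE kr mulr0 mul0r.
Qed.

(** With indices from 0, the range [r <= i] stands for σ_{r+1}, ..., σ_q. *)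
Lemma sqfrob_truncated_svd :
  sqfrob (first_cols hrq U *m diag_mx (first_cols hrq s) *m (first_cols hrq V)^T
            - A) = \sum_(i < minn m n | (r <= i)%N) s 0 i ^+ 2.
Proof.
case: hsvd => hU hV _ _ ->.
rewrite truncated_svdE -mulmxBl -mulmxBr -raddfB /= sqfrob_isometry //.
rewrite sqfrob_diag [RHS]big_mkcond; apply: eq_bigr => i _.
by rewrite !mxE; case: ltnP => _; rewrite ?subrr ?expr0n // sub0r sqrrN.
Qed.

Lemma eckart_young (B : 'M[R]_(m, n)) : (0 < r)%N -> (\rank B <= r)%N ->
  \sum_(i < minn m n | (r <= i)%N) s 0 i ^+ 2 <= sqfrob (B - A).
Proof.
move=> r0 rB; case: hsvd => hU hV s0 smono eA.
have [Q [Qsym Qidem QB trQ]] := orthogonal_projector B.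
(* Cyclicity of the trace removes [V]; the diagonal entries of U^T Q U are the weights p_i. *)
have QA : sqfrob (Q *m A) = \sum_i s 0 i ^+ 2 * (U^T *m Q *m U) i i.
  rewrite /sqfrob projector_gram // eA !trmx_mul trmxK tr_diag_mx.
  rewrite !mulmxA mxtrace_mulC !mulmxA hV mul1mx mxtrace_mulC !mulmxA.
  rewrite mulmx_diag -!(mulmxA (diag_mx _)) mul_diag_mx.
  by apply: eq_bigr => i _; rewrite [LHS]mxE [X in X * _]mxE expr2.
have sA : sqfrob A = \sum_i s 0 i ^+ 2.
  by rewrite eA sqfrob_isometry // sqfrob_diag.
have trunc : sqfrob (Q *m A) <= \sum_(i < minn m n | (i < r)%N) s 0 i ^+ 2.
  rewrite QA; apply: weighted_sum_le; rewrite ?r0 //.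
  - by move=> i; exact: sqr_ge0.
  - by move=> i j ij; rewrite ler_sqr ?nnegrE ?s0 // smono.
  - by move=> i; exact: projector_diag_itv.
  - apply: (le_trans (projector_trace_le _ Qsym Qidem _ hU)).
    by rewrite trQ ler_nat.
(* As Q fixes [B], the component of A - B orthogonal to the range of Q is A - Q A. *)
have AB : sqfrob (A - Q *m A) <= sqfrob (B - A).
  rewrite -(sqfrobN (B - A)) opprB (sqfrob_projector _ Qsym Qidem (A - B)).
  rewrite mulmxBr QB opprB addrA subrK.
  by rewrite lerDr sqfrob_ge0.
(* Pythagoras for [A]: |A - Q A|^2 is the full sum of squares minus |Q A|^2, hence at least the tail
   by [trunc]. *)
have := sqfrob_projector _ Qsym Qidem A; rewrite sA.
rewrite (bigID (fun i : 'I__ => (i < r)%N)) /=.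
under [X in _ + X = _ -> _]eq_bigl do rewrite -leqNgt.
lra.
Qed.

End ThinSVD.

Theorem theorem3p2 (R : realType) (d : measure_display) (T : measurableType d)
    (P : probability T R) (m n r : nat)
    (hr1 : (1 <= r)%N) (hrq : (r <= minn m n)%N)
    (W : 'M[R]_(m, n))
    (x : T -> 'rV[R]_m) (g : T -> 'rV[R]_n)
    (hx : finite_second_moment P x) (hg : finite_second_moment P g)
    (X : 'M[R]_m) (G : 'M[R]_n)
    (hX : X = second_moment P x) (hG : G = second_moment P g)
    (Sx : 'M[R]_m) (Sg : 'M[R]_n)
    (hSx : is_cholesky X Sx^T) (hSg : is_cholesky G Sg)
    (hSx_inv : Sx \in unitmx) (hSg_inv : Sg \in unitmx)
    (U : 'M[R]_(m, minn m n)) (s : 'rV[R]_(minn m n)) (V : 'M[R]_(n, minn m n))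
    (hsvd : is_thin_svd (Sx *m W *m Sg) U s V) :
  let Wstar := invmx Sx *m first_cols hrq U *m diag_mx (first_cols hrq s)
                 *m (first_cols hrq V)^T *m invmx Sg in
  [/\ (\rank Wstar <= r)%N,
      forall What : 'M[R]_(m, n), (\rank What <= r)%N ->
        kfac_loss X G W Wstar <= kfac_loss X G W What
    & kfac_loss X G W Wstar
        = 2^-1 * \sum_(i < minn m n | (r <= i)%N) s 0 i ^+ 2].
Proof.
move=> Wstar.
have eX : X = Sx^T *m Sx by case: hSx => _ _ ->; rewrite trmxK.
have eG : G = Sg *m Sg^T by case: hSg.
have eWstar : Sx *m Wstar *m Sg = first_cols hrq U
    *m diag_mx (first_cols hrq s) *m (first_cols hrq V)^T.
  by rewrite /Wstar !mulmxA mulmxV // mul1mx mulmxKV.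
have Jstar : kfac_loss X G W Wstar
    = 2^-1 * \sum_(i < minn m n | (r <= i)%N) s 0 i ^+ 2.
  by rewrite eX eG kfac_lossE eWstar (sqfrob_truncated_svd hrq hsvd).
split=> //.
(* Reassociating isolates a left factor with r columns, which bounds the rank. *)
- rewrite /Wstar -!mulmxA mulmxA.
  exact: leq_trans (mxrankM_maxl _ _) (rank_leq_col _).
- move=> What rWhat; rewrite Jstar eX eG kfac_lossE ler_pM2l ?invr_gt0 //.
  (* Multiplying by [Sx] and [Sg] does not raise the rank, so the whitened competitor is
     admissible. *)
  apply: (eckart_young hrq hsvd) => //.
  apply: leq_trans (mxrankM_maxl _ _) _.
  exact: leq_trans (mxrankM_maxr _ _) rWhat.
Qed.
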